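(* Let $\hat{\bm h}_k\in\hat{\mathcal H}_k$ be a fixed predictor (chosen independently of the samples), let $\alpha\in[0,1]$ and $\delta\in(0,1)$. Then, with probability at least $1-\delta$ over the draw of the samples $\hat{\mathcal D}_k$ and $\hat{\mathcal D}_{\text{proxy}}$, \[ \mathcal{L}_{\mathcal{D}_{\text{test}}}(\hat{\bm h}_k,\hat{\bm h}^* )\le \mathcal{L}_{\hat{\mathcal D}_k\cup\hat{\mathcal D}_{\text{proxy}}}(\hat{\bm h}_k)+\sqrt{\Big(\tfrac{2\alpha^2}{m_k}+\tfrac{2(1-\alpha)^2}{m_{\text{proxy}}}\Big)\log\tfrac{2}{\delta}}+\alpha\big[\lambda_k+d_{\mathcal G_k}(\mathcal D_k,\mathcal D_{\text{test}})\big] \] \[ +(1-\alpha)\Big[\lambda_{k,\text{proxy}}+d_{\mathcal G_k}(\mathcal D_{\text{proxy}},\mathcal D_{\text{test}})+p^{(1)}_{\text{proxy}}\,\mathcal L_{\mathcal D^{(1)}_{\text{proxy}}}(\hat{\bm h}^*,\bm h^*_{\text{proxy}})+p^{(2)}_{\text{proxy}}\,\mathcal L_{\mathcal D^{(2)}_{\text{proxy}}}(\hat{\bm h}^*_{\text{proxy}},\bm h^*_{\text{proxy}})\Big], \] where $p^{(1)}_{\text{proxy}}=\Pr_{\mathbf x\sim\mathcal D_{\text{proxy}}}[\hat{\bm h}^*(\mathbf x)\neq\hat{\bm h}^*_{\text{proxy}}(\mathbf x)]$, $p^{(2)}_{\text{proxy}}=\Pr_{\mathbf x\sim\mathcal D_{\text{proxy}}}[\hat{\bm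 h}^*(\mathbf x)=\hat{\bm h}^*_{\text{proxy}}(\mathbf x)]$ (so $p^{(1)}_{\text{proxy}}+p^{(2)}_{\text{proxy}}=1$), and $\mathcal D^{(1)}_{\text{proxy}}$, $\mathcal D^{(2)}_{\text{proxy}}$ are the distribution $\mathcal D_{\text{proxy}}$ conditioned on the events $\{\hat{\bm h}^*(\mathbf x)\neq\hat{\bm h}^*_{\text{proxy}}(\mathbf x)\}$ and $\{\hat{\bm h}^*(\mathbf x)=\hat{\bm h}^*_{\text{proxy}}(\mathbf x)\}$ respectively (a term is taken to be $0$ when its probability is $0$).
   Context: Let $\mathcal X$ be a (measurable) input space and $C\ge 2$ the number of classes. $\Delta^{C-1}\subset\mathbb R^C$ is the probability simplex and $V(\Delta^{C-1})$ its vertex set, i.e. the $C$ one-hot vectors. The ground-truth labeling function is $\hat{\bm h}^*:\mathcal X\to V(\Delta^{C-1})$. For a distribution $\mathcal D$ on $\mathcal X$ and functions $\bm h,\bm h':\mathcal X\to\Delta^{C-1}$, $\mathcal L_{\mathcal D}(\bm h,\bm h'):=\mathbb E_{\mathbf x\sim\mathcal D}\|\bm h(\mathbf x)-\bm h'(\mathbf x)\|_1$; for a finite sample $\hat{\mathcal D}$ this expectation is the empirical average over the sample. Client $k$ has a private distribution $\mathcal D_k$ on $\mathcal X$ and an i.i.d. sample $\hat{\mathcal D}_k$ of size $m_k$ from it; there is a proxy distribution $\mathcal D_{\text{proxy}}$ on $\mathcal X$ with an i.i.d. sample $\hat{\mathcal D}_{\text{proxy}}$ of size $m_{\text{proxy}}$,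 independent of $\hat{\mathcal D}_k$; $\mathcal D_{\text{test}}$ is a test distribution on $\mathcal X$. $\bm h^*_{\text{proxy}}:\mathcal X\to\Delta^{C-1}$ is a fixed (arbitrary) labeling function for proxy samples and $\hat{\bm h}^*_{\text{proxy}}:\mathcal X\to V(\Delta^{C-1})$ is its one-hot output (the vertex at its largest coordinate, ties broken by a fixed rule). $\hat{\mathcal H}_k$ is a class of functions $\mathcal X\to V(\Delta^{C-1})$ containing $\hat{\bm h}_k$. The training loss is $\mathcal L_{\hat{\mathcal D}_k\cup\hat{\mathcal D}_{\text{proxy}}}(\hat{\bm h}_k):=\alpha\,\mathcal L_{\hat{\mathcal D}_k}(\hat{\bm h}_k,\hat{\bm h}^* )+(1-\alpha)\,\mathcal L_{\hat{\mathcal D}_{\text{proxy}}}(\hat{\bm h}_k,\bm h^*_{\text{proxy}})$. Minimum combined losses: $\lambda_k=\inf_{\hat{\bm h}\in\hat{\mathcal H}_k}\{\mathcal L_{\mathcal D_{\text{test}}}(\hat{\bm h},\hat{\bm h}^* )+\mathcal L_{\mathcal D_k}(\hat{\bm h},\hat{\bm h}^* )\}$ and $\lambda_{k,\text{proxy}}=\inf_{\hat{\bm h}\in\hat{\mathcal H}_k}\{\mathcal L_{\mathcal D_{\text{test}}}(\hat{\bm h},\hat{\bm h}^* )+\mathcal L_{\mathcal D_{\text{proxy}}}(\hat{\bm h},\hat{\bm h}^* )\}$. $\mathcal G_k$ is the set of functions $g:\mathcal X\to\{0,1\}$ of the form $g(\mathbf x)=\tfrac12\|\hat{\bm h}(\mathbf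 x)-\hat{\bm h}'(\mathbf x)\|_1$ with $\hat{\bm h},\hat{\bm h}'\in\hat{\mathcal H}_k$. For distributions $\mathcal D,\mathcal D'$ on $\mathcal X$, the $\mathcal G_k$-distance is $d_{\mathcal G_k}(\mathcal D,\mathcal D')=2\sup_{g\in\mathcal G_k}\big|\Pr_{\mathcal D}[g(\mathbf x)=1]-\Pr_{\mathcal D'}[g(\mathbf x)=1]\big|$. *)

(* Defs.v *)
From HB Require Import structures.
From mathcomp Require Import all_boot all_order all_algebra.
From mathcomp Require Import all_classical all_reals all_analysis.
Set Implicit Arguments. Unset Strict Implicit. Unset Printing Implicit Defensive.
Import Order.TTheory GRing.Theory Num.Theory.
Import numFieldNormedType.Exports.
Local Open Scope classical_set_scope.
Local Open Scope ring_scope.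

Definition l1dist (R : realType) (C : nat) (u v : 'I_C -> R) : R :=
  \sum_(i < C) `|u i - v i|.

Definition in_simplex (R : realType) (C : nat) (u : 'I_C -> R) : Prop :=
  (forall i, 0 <= u i) /\ \sum_(i < C) u i = 1.

Definition onehot (R : realType) (C : nat) (c : 'I_C) : 'I_C -> R :=
  fun i => (i == c)%:R.

Definition is_vertex (R : realType) (C : nat) (u : 'I_C -> R) : Prop :=
  exists c : 'I_C, u = onehot R c.

Definition meas_vec (d : measure_display) (X : measurableType d)
  (R : realType) (C : nat) (h : X -> 'I_C -> R) : Prop :=
  forall i : 'I_C, measurable_fun setT (fun x => h x i).

Definition loss (d : measure_display) (X : measurableType d) (R : realType)
  (C : nat) (mu : {measure set X -> \bar R}) (h h' : X -> 'I_C -> R) : R :=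
  fine (\int[mu]_x (l1dist (h x) (h' x))%:E).

Definition emp_loss (d : measure_display) (X : measurableType d) (R : realType)
  (C m : nat) (S : 'I_m -> X) (h h' : X -> 'I_C -> R) : R :=
  (m%:R)^-1 * \sum_(i < m) l1dist (h (S i)) (h' (S i)).

Definition cond_loss (d : measure_display) (X : measurableType d) (R : realType)
  (C : nat) (mu : {measure set X -> \bar R}) (E : set X) (h h' : X -> 'I_C -> R) : R :=
  if fine (mu E) == 0 then 0
  else fine (\int[mu]_(x in E) (l1dist (h x) (h' x))%:E) / fine (mu E).

Definition min_comb_loss (d : measure_display) (X : measurableType d) (R : realType)
  (C : nat) (H : set (X -> 'I_C -> R)) (D1 D2 : {measure set X -> \bar R})
  (f : X -> 'I_C -> R) : R :=
  inf [set loss D1 h f + loss D2 h f | h in H].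

Definition Gclass (d : measure_display) (X : measurableType d) (R : realType)
  (C : nat) (H : set (X -> 'I_C -> R)) : set (X -> R) :=
  [set g | exists h h', [/\ H h, H h' &
     g = fun x => 2^-1 * l1dist (h x) (h' x)]].

Definition Gdist (d : measure_display) (X : measurableType d) (R : realType)
  (C : nat) (H : set (X -> 'I_C -> R)) (D D' : {measure set X -> \bar R}) : R :=
  2 * sup [set `| fine (D [set x | g x = 1]) - fine (D' [set x | g x = 1]) |
           | g in Gclass H].

Definition has_law (dO d : measure_display) (Omega : measurableType dO)
  (X : measurableType d) (R : realType) (P : {measure set Omega -> \bar R})
  (Y : Omega -> X) (D : {measure set X -> \bar R}) : Prop :=
  forall A : set X, measurable A -> P (Y @^-1` A) = D A.

(* mutual independence of a finite family of X-valued random variables: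
   the product rule for every choice of measurable sets (taking A i = setT
   recovers every subfamily). *)
Definition mutually_independent (dO d : measure_display) (Omega : measurableType dO)
  (X : measurableType d) (R : realType) (I : finType)
  (P : {measure set Omega -> \bar R}) (Y : I -> Omega -> X) : Prop :=
  forall A : I -> set X, (forall i, measurable (A i)) ->
    fine (P (\bigcap_(i in setT) (Y i @^-1` A i))) =
    \prod_(i : I) fine (P (Y i @^-1` A i)).

(* Main.v *)
(**
The bound splits into a deterministic and a probabilistic part.

For one-hot predictors the L1 loss is twice the probability of disagreement, so
passing from D to D' costs at most the G-distance; inserting an arbitrary
[h] of the class by the triangle inequality and taking the infimum over [h]
gives [L_{D'}(hk, hstar) <= L_D(hk, hstar) + lambda + d_G(D, D')].  On the proxy
distribution [L(hk, hstar) <= L(hk, hpstar) + L(hstar, hpstar)], and the last term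
is split over the events [hstar <> hpstar_hat] and [hstar = hpstar_hat], where in
the second one [hstar] may be replaced by [hpstar_hat].

The passage from [alpha L_{D_k} + (1 - alpha) L_{D_proxy}] to its empirical
counterpart is the one-sided Hoeffding inequality for the independent variables
[alpha / m_k * l(S_i)] and [(1 - alpha) / m_proxy * l(T_j)] with [l] in [[0, 2]]:
the failure probability is at most [delta / 2].
*)
Require Import Defs.
From HB Require Import structures.
From mathcomp Require Import all_boot all_order all_algebra.
From mathcomp Require Import all_classical all_reals all_analysis.
From mathcomp Require Import measurable_realfun.
From mathcomp Require Import ring lra.
Import Order.TTheory GRing.Theory Num.Theory.
Import numFieldNormedType.Exports.
Local Open Scope classical_set_scope.
Local Open Scope ring_scope.

Set Implicit Arguments.
Unset Strict Implicit.
Unset Printing Implicit Defensive.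

(** * Calculus for the moment generating function of a Bernoulli variable *)

Lemma scaleRE (R : realType) (a b : R) : a *: b = a * b.
Proof. by []. Qed.

Lemma le_at0_of_derive (R : realType) (f df : R -> R) (x : R) :
  (forall y : R, 0 <= y -> is_derive y (1 : R) f (df y)) ->
  (forall y : R, 0 <= y -> 0 <= df y) -> 0 <= x -> f 0 <= f x.
Proof.
move=> fdf df0 x0; rewrite -subr_ge0.
have [||c] := @MVT_segment R f df 0 x x0.
- by move=> y; rewrite in_itv/= => /andP[/ltW y0 _]; exact: fdf.
- apply: derivable_within_continuous => y; rewrite in_itv/= => /andP[y0 _].
  exact: (@ex_derive _ _ _ _ _ _ _ (fdf y y0)).
by rewrite in_itv/= => /andP[c0 _] ->; rewrite subr0 mulr_ge0// df0.
Qed.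

Section hoeffding_scalar.
Variables (R : realType) (p : R).
Hypothesis p01 : 0 <= p <= 1.

Let g (h : R) := 1 - p + p * expR (- h).

Let g_gt0 h : 0 < g h.
Proof.
have := expR_gt0 (- h); rewrite /g.
have /andP[] := p01; rewrite le_eqVlt => /predU1P[<- _|p0 p1] e0; first lra.
by rewrite ltr_wpDl ?mulr_gt0// subr_ge0.
Qed.

Let is_derive_g (h : R) : is_derive h (1 : R) g (- (p * expR (- h))).
Proof.
rewrite /g.
have -> : (fun h => 1 - p + p * expR (- h)) =
          cst (1 - p) + (p \*: (fun t => expR (- t))) by [].
apply: is_derive_eq.
by rewrite add0r /= ?scaleRE; ring.
Qed.

(** The quotient [q = p * expR (- h) / g h] is the success probability of the exponentially tilted
    Bernoulli law. It equals [p] at [h = 0], and its derivative is minus the variance [q * (1 - q)],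
    which is at least [- 1 / 4]. *)
Let tilt_ge (h : R) : 0 <= h -> p - h / 4 <= p * expR (- h) / g h.
Proof.
move=> h0; rewrite -subr_ge0.
pose psi (t : R) := p * expR (- t) / g t - (p - t / 4).
pose dpsi (t : R) := 1 / 4 - (1 - p) * (p * expR (- t)) / (g t) ^+ 2.
have := @le_at0_of_derive R psi dpsi h _ _ h0.
rewrite /psi /g oppr0 expR0 mulr1 subrK divr1 mul0r subr0 subrr -/(g h); apply.
- move=> t t0; rewrite /psi.
  have -> : (fun t => p * expR (- t) / g t - (p - t / 4)) =
      (p \*: (fun t => expR (- t))) * (fun t => (g t)^-1)
      + (cst (- p) + (4^-1 \*: id)).
    apply/funext => u /=; rewrite !fctE/= ?scaleRE.
    by ring.
  have gt := lt0r_neq0 (g_gt0 t).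
  have dV := is_deriveV gt (is_derive_g t).
  apply: is_derive_eq.
  rewrite /dpsi /= ?scaleRE /cst.
  have Eg : g t = 1 - p + p * expR (- t) by [].
  have -> : 1 - p = g t - p * expR (- t) by rewrite Eg; ring.
  by field.
- move=> t t0; rewrite /dpsi subr_ge0 ler_pdivrMr ?exprn_gt0//.
  (* The difference [(g t) ^+ 2 - 4 * (1 - p) * (p * expR (- t))] is exactly this square. *)
  rewrite /g; have := sqr_ge0 (1 - p - p * expR (- t)); nra.
Qed.

(** Hoeffding's lemma for a Bernoulli variable. The logarithmic derivative of
    [g t * expR (p * t - t ^+ 2 / 8)] is [p - t / 4] minus the tilted mean, hence nonpositive by
    [tilt_ge]; the product therefore stays below its value 1 at 0. Its negative [F] is used so that
    the monotonicity lemma for nonnegative derivatives applies. *)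
Lemma bernoulli_mgf_le (h : R) : 0 <= h ->
  1 - p + p * expR (- h) <= expR (- (p * h) + h ^+ 2 / 8).
Proof.
move=> h0.
pose F (t : R) := - (g t * expR (p * t - t ^+ 2 / 8)).
pose dF (t : R) := g t * expR (p * t - t ^+ 2 / 8) *
   (p * expR (- t) / g t - (p - t / 4)).
have F0 : F 0 = - 1.
  by rewrite /F /g oppr0 expR0 mulr1 subrK mulr0 expr0n/= mul0r subr0 expR0 mulr1.
have := @le_at0_of_derive R F dF h _ _ h0; rewrite F0 [F h]/F lerN2 => H.
have E : expR (- (p * h) + h ^+ 2 / 8) = (expR (p * h - h ^+ 2 / 8))^-1.
  by rewrite -expRN opprB addrC.
rewrite -/(g h) E -div1r ler_pdivlMr ?expR_gt0//.
apply: H.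
- move=> t t0; rewrite /F.
  have dE : is_derive t (1 : R) (fun t => expR (p * t - t ^+ 2 / 8))
     (expR (p * t - t ^+ 2 / 8) * (p - t / 4)).
    have dI : is_derive t (1 : R) (fun t => p * t - t ^+ 2 / 8) (p - t / 4).
      have -> : (fun t => p * t - t ^+ 2 / 8) =
          (p \*: id) + ((- 8^-1) \*: (@id R ^+ 2)).
        by apply/funext => u /=; rewrite !fctE/= ?scaleRE; ring.
      by apply: is_derive_eq; rewrite /= ?scaleRE; field.
    exact: (@is_derive1_comp R expR _ t _ _ (is_derive_expR _) dI).
  have -> : (fun t => - (g t * expR (p * t - t ^+ 2 / 8))) =
      - (g * (fun t => expR (p * t - t ^+ 2 / 8))) by [].
  apply: is_derive_eq; rewrite /dF /= ?scaleRE.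
  have gt := lt0r_neq0 (g_gt0 t).
  by field.
- move=> t t0; rewrite /dF mulr_ge0//.
    by rewrite mulr_ge0 ?expR_ge0// ltW.
  by rewrite subr_ge0 tilt_ge.
Qed.

End hoeffding_scalar.

(** * Expectation of a product of functions of independent variables *)

Section product_rule.
Context (dO d : measure_display) (Omega : measurableType dO)
  (X : measurableType d) (R : realType).
Variable P : {measure set Omega -> \bar R}.
Local Open Scope ereal_scope.
Import HBNNSimple.

(* Indicators determine integrals: the identity passes to simple functions by
   linearity and to nonnegative functions by monotone convergence. *)
Lemma ge0_integral_weight (W : Omega -> R) (Y : Omega -> X) (c : R)
    (f : X -> R) :
  measurable_fun setT W -> (forall w, 0 <= W w)%R ->
  measurable_fun setT Y -> (0 <= c)%R ->
  (forall A, measurable A ->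
    \int[P]_w (W w * \1_A (Y w))%:E = c%:E * \int[P]_w (\1_A (Y w))%:E) ->
  measurable_fun setT f -> (forall x, 0 <= f x)%R ->
  \int[P]_w (W w * f (Y w))%:E = c%:E * \int[P]_w (f (Y w))%:E.
Proof.
move=> mW W0 mY c0 WA mf f0.
have meY (k : X -> R) : measurable_fun setT k ->
    measurable_fun setT (EFin \o (fun w => k (Y w))).
  by move=> mk; apply/measurable_EFinP; exact: measurableT_comp.
have mWY (k : X -> R) : measurable_fun setT k ->
    measurable_fun setT (EFin \o (fun w => W w * k (Y w))%R).
  move=> mk; apply/measurable_EFinP; apply: measurable_funM => //.
  exact: measurableT_comp.
have mef : measurable_fun setT (EFin \o f) by exact/measurable_EFinP.
pose f_ := nnsfun_approx measurableT mef.
have cvf x : (f_ n x)%:E @[n --> \oo] --> (f x)%:E.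
  by apply: (@cvg_nnsfun_approx _ _ _ _ measurableT _ mef) => // y _;
    rewrite lee_fin.
have ndf x m n : (m <= n)%N -> (f_ m x <= f_ n x)%R.
  by move=> mn; exact/lefP/nd_nnsfun_approx.
have simple n : \int[P]_w (W w * f_ n (Y w))%:E =
    c%:E * \int[P]_w (f_ n (Y w))%:E.
  have mI r : measurable (f_ n @^-1` [set r]) by [].
  (* The simple function [f_ n] is expanded over its finitely many values, since [WA] applies to the
     indicator of each level set. *)
  transitivity (\sum_(r \in range (f_ n))
      \int[P]_w (r%:E * (W w * \1_(f_ n @^-1` [set r]) (Y w))%:E)).
    rewrite -ge0_integral_fsum//; first last.
    - move=> r w _; rewrite -EFinM lee_fin mulrCA mulr_ge0//.
      by rewrite -lee_fin nnfun_muleindic_ge0.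
    - move=> r; apply: measurable_funeM; exact: mWY.
    - apply: eq_integral => w _; rewrite {1}(fimfunE (f_ n) (Y w)).
      rewrite EFinM -fsumEFin// ge0_mule_fsumr; last first.
        by move=> r; rewrite nnfun_muleindic_ge0.
      by apply: eq_fsbigr => r _; rewrite !EFinM muleCA.
  transitivity (\sum_(r \in range (f_ n))
      c%:E * \int[P]_w (r * \1_(f_ n @^-1` [set r]) (Y w))%:E).
    apply: eq_fsbigr => r /[!inE] -[x _ <-].
    have mJ : measurable_fun setT
        (EFin \o (fun w => \1_(f_ n @^-1` [set f_ n x]) (Y w) : R)).
      exact: meY.
    rewrite ge0_integralZl//; last 3 first.
    - exact: mWY.
    - by move=> w _; rewrite lee_fin mulr_ge0.
    - by rewrite lee_fin.
    rewrite WA// muleCA; congr (_ * _).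
    by under [RHS]eq_integral do rewrite EFinM; rewrite ge0_integralZl// lee_fin.
  rewrite -ge0_mule_fsumr; last first.
    move=> r; apply: integral_ge0 => w _; rewrite nnfun_muleindic_ge0//.
  rewrite -ge0_integral_fsum//; last 2 first.
  - move=> r; apply/measurable_EFinP; apply: measurable_funM => //.
    exact/measurable_EFinP/meY.
  - by move=> r w _; rewrite nnfun_muleindic_ge0.
  congr (_ * _); apply: eq_integral => w _.
  by rewrite fsumEFin// -fimfunE.
have lhs : \int[P]_w (W w * f_ n (Y w))%:E @[n --> \oo] -->
    \int[P]_w (W w * f (Y w))%:E.
  rewrite [X in _ --> X](_ : _ =
      \int[P]_w limn (fun n => (W w * f_ n (Y w))%:E)); last first.
    apply: eq_integral => w _; apply/esym/cvg_lim => //.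
    exact: (@cvgeZl _ _ _ _ _ (W w)%:E isT (cvf (Y w))).
  apply: cvg_monotone_convergence => //.
  - by move=> n; exact: mWY.
  - by move=> n w _; rewrite lee_fin mulr_ge0.
  - by move=> w _ m n mn; rewrite lee_fin ler_wpM2l// ndf.
have rhs : \int[P]_w (f_ n (Y w))%:E @[n --> \oo] --> \int[P]_w (f (Y w))%:E.
  rewrite [X in _ --> X](_ : _ =
      \int[P]_w limn (fun n => (f_ n (Y w))%:E)); last first.
    by apply: eq_integral => w _; apply/esym/cvg_lim.
  apply: cvg_monotone_convergence => //.
  - by move=> n; exact: meY.
  - by move=> n w _; rewrite lee_fin.
  - by move=> w _ m n mn; rewrite lee_fin ndf.
have := @cvgeZl _ _ _ _ _ c%:E isT rhs.
under eq_cvg do rewrite -simple.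
by move=> /(cvg_unique _ lhs); exact.
Qed.

End product_rule.

Section independent_product.
Context (dO d : measure_display) (Omega : measurableType dO)
  (X : measurableType d) (R : realType) (I : finType).
Variables (P : probability Omega R) (Y : I -> Omega -> X).
Hypothesis mY : forall i, measurable_fun setT (Y i).
Hypothesis indepY : mutually_independent P Y.

Let indic_comp (A : set X) i w : \1_A (Y i w) = \1_(Y i @^-1` A) w :> R.
Proof. by []. Qed.

Let measurable_pre A i : measurable A -> measurable (Y i @^-1` A).
Proof. by move=> mA; rewrite -[_ @^-1` _]setTI; exact: mY. Qed.

Let integral_indic_comp A i : measurable A ->
  (\int[P]_w (\1_A (Y i w))%:E)%E = (fine (P (Y i @^-1` A)))%:E.
Proof.
move=> mA; under eq_integral do rewrite indic_comp.
rewrite integral_indic//; last exact: measurable_pre.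
by rewrite setIT fineK// fin_num_measure//; exact: measurable_pre.
Qed.

(* The factors indexed outside [s] are indicators; enlarging [s] replaces them
   one at a time by arbitrary nonnegative functions. *)
Let integral_prod_mixed (s : seq I) (f : I -> X -> R) (e : I -> R) :
  (forall i, i \notin s -> exists2 A, measurable A & f i = \1_A) ->
  (forall i, measurable_fun setT (f i)) -> (forall i x, 0 <= f i x) ->
  (forall i, (\int[P]_w (f i (Y i w))%:E)%E = (e i)%:E) ->
  (\int[P]_w (\prod_i f i (Y i w))%:E)%E = (\prod_i e i)%:E.
Proof.
elim: s f e => [|j s IH] f e fA mf f0 fe.
  (* Base case: every factor is the indicator of some [A i], and their product is the indicator of
     the intersection in the product rule. *)
  have fA' i : exists A, measurable A /\ f i = \1_A.
    by have [A mA fiA] := fA i isT; exists A.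
  have [A /all_and2[mA fAE]] := choice fA'.
  have eE i : e i = fine (P (Y i @^-1` A i)).
    by apply: EFin_inj; rewrite -fe fAE integral_indic_comp.
  under eq_bigr do rewrite eE.
  rewrite -indepY// fineK; last first.
    apply: fin_num_measure; apply: fin_bigcap_measurable => // i _.
    exact: measurable_pre.
  rewrite -[X in _ = _ X]setIT -integral_indic//; last first.
    by apply: fin_bigcap_measurable => // i _; exact: measurable_pre.
  apply: eq_integral => w _; congr EFin.
  rewrite indicE; have [wA|/existsNP[i wA]] := pselect (forall i, A i (Y i w)).
    rewrite mem_set; last by move=> i _; exact: wA.
    by rewrite big1// => i _; rewrite fAE indicE mem_set.
  rewrite memNset; last by move=> /(_ i Logic.I).
  by rewrite (bigD1 i)//= fAE indicE memNset// mul0r.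
have e0 i : 0 <= e i.
  by rewrite -lee_fin -fe; apply: integral_ge0 => w _; rewrite lee_fin.
(* The factors other than [j] form the weight, and the product of their expectations is the
   constant; only the case where the factor at [j] is an indicator remains. *)
under eq_integral do rewrite (bigD1 j)//= mulrC.
rewrite (@ge0_integral_weight _ _ _ _ _ P _ _ (\prod_(i | i != j) e i) (f j))//.
- by rewrite fe -EFinM [in RHS](bigD1 j)//= mulrC.
- under eq_fun do rewrite big_mkcond.
  apply: measurable_prod => i _; case: (i != j) => //.
  exact: measurableT_comp.
- by move=> w; apply: prodr_ge0.
- exact: prodr_ge0.
move=> A mA.
(* With the indicator of [A] in slot [j], all factors outside [s] are indicators again and the
   induction hypothesis applies. *)
pose f' i : X -> R := if i == j then \1_A else f i.
pose e' i := if i == j then fine (P (Y j @^-1` A)) else e i.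
have e'j : e' j = fine (P (Y j @^-1` A)) by rewrite /e' eqxx.
have := IH f' e'; rewrite (bigD1 j)//= e'j.
rewrite (eq_bigr e); last by move=> i /negbTE ij; rewrite /e' ij.
rewrite integral_indic_comp// -EFinM mulrC => <-.
- apply: eq_integral => w _; rewrite [in RHS](bigD1 j)//= {1}/f' eqxx mulrC.
  by congr (_ * _)%:E; apply: eq_bigr => i /negbTE ij; rewrite /f' ij.
- move=> i /negP ins; rewrite /f'; have [_|ij] := eqVneq i j; first by exists A.
  by apply: fA; rewrite inE (negbTE ij); exact/negP.
- by move=> i; rewrite /f'; case: ifP.
- by move=> i x; rewrite /f'; case: ifP.
- by move=> i; rewrite /f' /e'; case: eqP => [->|_ //]; rewrite integral_indic_comp.
Qed.

(** With the list of all indices in [integral_prod_mixed], no factor is required to be an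
    indicator. *)
Lemma independent_integral_prod (f : I -> X -> R) (e : I -> R) :
  (forall i, measurable_fun setT (f i)) -> (forall i x, 0 <= f i x) ->
  (forall i, (\int[P]_w (f i (Y i w))%:E)%E = (e i)%:E) ->
  (\int[P]_w (\prod_i f i (Y i w))%:E)%E = (\prod_i e i)%:E.
Proof.
by apply: (@integral_prod_mixed (enum I)) => i; rewrite mem_enum inE.
Qed.

End independent_product.

(** * The L1 distance on the simplex and on its vertices *)

Section l1dist_lemmas.
Variables (R : realType) (C : nat).
Implicit Types u v w : 'I_C -> R.

Lemma l1dist_ge0 u v : 0 <= l1dist u v.
Proof. exact: sumr_ge0. Qed.

Lemma l1distC u v : l1dist u v = l1dist v u.
Proof. by apply: eq_bigr => i _; rewrite distrC. Qed.

Lemma l1dist_triangle w u v : l1dist u v <= l1dist u w + l1dist w v.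
Proof. by rewrite /l1dist -big_split ler_sum//= => i _; exact: ler_distD. Qed.

Lemma vertex_simplex u : is_vertex u -> in_simplex u.
Proof.
move=> [c ->]; split=> [i|]; first by rewrite /onehot ler0n.
by rewrite (bigD1 c)//= /onehot eqxx big1 ?addr0// => i /negbTE ->.
Qed.

Lemma l1dist_simplex_le2 u v : in_simplex u -> in_simplex v -> l1dist u v <= 2.
Proof.
move=> [u0 u1] [v0 v1]; rewrite (_ : 2 = \sum_(i < C) (u i + v i)); last first.
  by rewrite big_split/= u1 v1.
apply: ler_sum => i _; rewrite (le_trans (ler_normB _ _))//.
by rewrite !ger0_norm.
Qed.

(** Distinct one-hot vectors differ in exactly two coordinates, by one in each; half the distance is
    thus the indicator of disagreement. *)
Lemma l1dist_vertex u v : is_vertex u -> is_vertex v ->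
  l1dist u v = 0 \/ l1dist u v = 2.
Proof.
move=> [a ->] [b ->]; have [->|ab] := eqVneq a b.
  by left; rewrite /l1dist big1// => i _; rewrite subrr normr0.
right; rewrite /l1dist (bigD1 a)//= (bigD1 b)/=; last by rewrite eq_sym.
rewrite /onehot !eqxx (negbTE ab) eq_sym (negbTE ab) subr0 sub0r normrN normr1.
by rewrite big1 ?addr0// => i /andP[/negbTE -> /negbTE ->]; rewrite subrr normr0.
Qed.

End l1dist_lemmas.

(** * Population losses: change of distribution and splitting over events *)

Section loss_lemmas.
Context (d : measure_display) (X : measurableType d) (R : realType) (C : nat).
Implicit Types (D : probability X R) (h : X -> 'I_C -> R).

Definition simplex_predictor h := meas_vec h /\ forall x, in_simplex (h x).

Lemma vertex_simplex_predictor h :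
  meas_vec h -> (forall x, is_vertex (h x)) -> simplex_predictor h.
Proof. by move=> mh hv; split=> // x; exact: vertex_simplex. Qed.

Lemma measurable_l1dist h h' : meas_vec h -> meas_vec h' ->
  measurable_fun setT (fun x => l1dist (h x) (h' x)).
Proof.
move=> mh mh'; apply: measurable_sum => i.
by apply: measurableT_comp => //; exact: measurable_funB.
Qed.

Lemma integrable_bounded (D : probability X R) (f : X -> R) (M : R) :
  measurable_fun setT f -> (forall x, `|f x| <= M) ->
  D.-integrable setT (EFin \o f).
Proof.
move=> mf fM; apply: measurable_bounded_integrable => //.
  by rewrite -ge0_fin_numE// fin_num_measure.
exists M; split; first exact: num_real.
by move=> N MN x _ /=; rewrite (le_trans (fM x))// ltW.
Qed.

Lemma integrable_l1dist D h h' : simplex_predictor h -> simplex_predictor h' ->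
  D.-integrable setT (EFin \o (fun x => l1dist (h x) (h' x))).
Proof.
move=> [mh sh] [mh' sh']; apply: (@integrable_bounded _ _ 2).
  exact: measurable_l1dist.
by move=> x; rewrite ger0_norm ?l1dist_ge0// l1dist_simplex_le2.
Qed.

Lemma lossE D h h' : loss D h h' = \int[D]_x l1dist (h x) (h' x).
Proof. by []. Qed.

Lemma loss_triangle D h2 h1 h3 : simplex_predictor h1 -> simplex_predictor h2 ->
  simplex_predictor h3 -> loss D h1 h3 <= loss D h1 h2 + loss D h2 h3.
Proof.
move=> s1 s2 s3; rewrite !lossE -RintegralD//; [|exact: integrable_l1dist..].
apply: le_Rintegral => //; first exact: integrable_l1dist.
- apply: (@integrable_bounded _ _ 4).
    by apply: measurable_funD; apply: measurable_l1dist;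
      case: s1 s2 s3 => ? ? [? ?] [].
  move=> x; rewrite ger0_norm ?addr_ge0 ?l1dist_ge0//.
  case: s1 s2 s3 => _ s1 [_ s2] [_ s3].
  have := l1dist_simplex_le2 (s1 x) (s2 x).
  have := l1dist_simplex_le2 (s2 x) (s3 x); lra.
- by move=> x _; exact: l1dist_triangle.
Qed.

Lemma lossC D h h' : loss D h h' = loss D h' h.
Proof. by rewrite /loss; under eq_integral do rewrite l1distC. Qed.

(** The integrand is twice the indicator of disagreement. This puts the loss in the form of the
    probabilities compared in [Gdist]. *)
Lemma loss_vertexE D h h' : meas_vec h -> meas_vec h' ->
  (forall x, is_vertex (h x)) -> (forall x, is_vertex (h' x)) ->
  loss D h h' = 2 * fine (D [set x | 2^-1 * l1dist (h x) (h' x) = 1]).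
Proof.
move=> mh mh' vh vh'; set A := [set x | _].
have mA : measurable A.
  have mg : measurable_fun setT (fun x => 2^-1 * l1dist (h x) (h' x)).
    by apply: measurable_funM => //; exact: measurable_l1dist.
  by rewrite -[A]setTI; exact: (mg measurableT [set 1]).
have E x : l1dist (h x) (h' x) = 2 * \1_A x.
  rewrite indicE; have [e|e] := l1dist_vertex (vh x) (vh' x); rewrite e.
    rewrite memNset ?mulr0// /A/= e mulr0 => /eqP.
    by rewrite eq_sym oner_eq0.
  by rewrite mem_set ?mulr1// /A/= e mulVf.
rewrite /loss; under eq_integral do rewrite E EFinM.
rewrite ge0_integralZl//; last exact/measurable_EFinP.
by rewrite integral_indic// setIT fineM// fin_num_measure.
Qed.

Lemma loss_le_Gdist (H : set (X -> 'I_C -> R)) D D' h h' :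
  (forall h, H h -> forall x, is_vertex (h x)) ->
  (forall h, H h -> meas_vec h) -> H h -> H h' ->
  loss D' h h' <= loss D h h' + Gdist H D D'.
Proof.
move=> vH mH Hh Hh'.
rewrite !loss_vertexE; [|by [exact: mH|exact: vH]..].
rewrite -mulrDr ler_pM2l// -lerBlDl.
set g := fun x => 2^-1 * l1dist (h x) (h' x).
rewrite (le_trans (ler_norm _))// distrC.
apply: ub_le_sup; last by exists g => //; exists h, h'.
(* A real [sup] dominates its set only if the set is bounded above; two probabilities differ by at
   most 1. *)
exists 1 => _ [k [k1 [k2 [Hk1 Hk2 ->]]] <-].
have mA : measurable [set x | 2^-1 * l1dist (k1 x) (k2 x) = 1].
  have mg : measurable_fun setT (fun x => 2^-1 * l1dist (k1 x) (k2 x)).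
    by apply: measurable_funM => //; apply: measurable_l1dist; exact: mH.
  by rewrite -[X in measurable X]setTI; exact: (mg measurableT [set 1]).
have b (Q : probability X R) :
    0 <= fine (Q [set x | 2^-1 * l1dist (k1 x) (k2 x) = 1]) <= 1.
  rewrite fine_ge0//= -lee_fin fineK ?fin_num_measure//.
  exact: probability_le1.
by have := b D; have := b D'; rewrite ler_norml; lra.
Qed.

(** Since [f] may lie outside the class, the change of distribution is applied only to a pair [h],
    [k] of class members; the triangle inequality leads from [f] to [k] under [D] and back under
    [D'], at the cost of the two losses of [k]. *)
Lemma loss_transfer (H : set (X -> 'I_C -> R)) D D' h f :
  (forall h, H h -> forall x, is_vertex (h x)) ->
  (forall h, H h -> meas_vec h) -> simplex_predictor f -> H h ->
  loss D' h f <= loss D h f + min_comb_loss H D' D f + Gdist H D D'.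
Proof.
move=> vH mH sf Hh.
have sH k : H k -> simplex_predictor k.
  by move=> Hk; apply: vertex_simplex_predictor; [exact: mH|exact: vH].
rewrite -lerBlDr -lerBlDl; apply: lb_le_inf.
  (* The set under [inf] must be nonempty; [h] itself gives an element. *)
  by exists (loss D' h f + loss D h f); exists h.
move=> _ [k Hk <-].
have t' := loss_triangle D' (sH _ Hh) (sH _ Hk) sf.
have t := loss_triangle D (sH _ Hh) sf (sH _ Hk).
have G := loss_le_Gdist D D' vH mH Hh Hk.
by rewrite (lossC D f k) in t; lra.
Qed.

(** For positive mass the normalisation cancels; for mass zero the convention in [cond_loss] agrees
    with the vanishing integral over a null set. *)
Lemma mass_cond_loss D (E : set X) h h' : measurable E ->
  simplex_predictor h -> simplex_predictor h' ->
  fine (D E) * cond_loss D E h h' =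
  fine (\int[D]_(x in E) (l1dist (h x) (h' x))%:E)%E.
Proof.
move=> mE [mh sh] [mh' sh']; rewrite /cond_loss.
case: eqP => [DE0|/eqP DE]; last first.
  by rewrite mulrC divfK.
have DE : D E = 0%E.
  by rewrite -[LHS]fineK ?fin_num_measure// DE0.
rewrite mulr0 (@ge0_negligible_integral _ _ _ _ E E)//.
- by rewrite setDv integral_set0.
- by apply/measurable_EFinP/measurable_funTS; exact: measurable_l1dist.
- by move=> x _; rewrite lee_fin l1dist_ge0.
Qed.

Lemma measurable_eq_vec h h' : meas_vec h -> meas_vec h' ->
  measurable [set x | h x = h' x].
Proof.
move=> mh mh'.
have -> : [set x | h x = h' x] = \bigcap_(i in @setT 'I_C) [set x | h x i = h' x i].
  apply/seteqP; split=> x /=.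
    by move=> e i _ /=; rewrite e.
  by move=> e; apply/funext => i; exact: e.
apply: fin_bigcap_measurable => // i _.
rewrite -[X in measurable X]setTI.
rewrite (_ : [set x | h x i = h' x i] = (fun x => h x i - h' x i) @^-1` [set 0]).
  have mB : measurable_fun setT (fun x => h x i - h' x i).
    exact: measurable_funB (mh i) (mh' i).
  exact: (mB measurableT [set 0]).
apply/seteqP; split=> x /=; first by move=> ->; rewrite subrr.
by move/eqP; rewrite subr_eq0 => /eqP.
Qed.

Lemma loss_split D h k f : simplex_predictor h -> simplex_predictor k ->
  simplex_predictor f ->
  let E1 := [set x | h x <> k x] in
  let E2 := [set x | h x = k x] in
  loss D h f = fine (D E1) * cond_loss D E1 h f + fine (D E2) * cond_loss D E2 k f.
Proof.
move=> sh sk sf E1 E2.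
have mE2 : measurable E2 by apply: measurable_eq_vec; [case: sh|case: sk].
have mE1 : measurable E1 by exact: measurableC.
rewrite !mass_cond_loss//.
have -> : (\int[D]_(x in E2) (l1dist (k x) (f x))%:E)%E =
          (\int[D]_(x in E2) (l1dist (h x) (f x))%:E)%E.
  by apply: eq_integral => x /[!inE] /= ->.
have ih := integrable_l1dist D sh sf.
rewrite /loss -[setT](setvU E2).
have := @Rintegral_setU _ _ _ D E1 E2 (fun x => l1dist (h x) (f x)) mE1 mE2.
rewrite /Rintegral; apply.
  by rewrite setvU.
by apply/disj_set2P; rewrite setICl.
Qed.

End loss_lemmas.

(** * Hoeffding's inequality for weighted sums of independent variables *)

Lemma expR_le_chord (R : realType) (t b : R) : 0 <= t <= 1 ->
  expR (t * b) <= 1 - t + t * expR b.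
Proof.
(* Both endpoint values lie above the tangent at [t * b]. *)
move=> /andP[t0 t1].
have e1 : expR (t * b) * (1 - t * b) <= 1.
  have := expR_ge1Dx (- (t * b)); rewrite -(ler_pM2l (expR_gt0 (t * b))).
  by rewrite -expRD subrr expR0.
have e2 : expR (t * b) * (1 + (b - t * b)) <= expR b.
  have := expR_ge1Dx (b - t * b); rewrite -(ler_pM2l (expR_gt0 (t * b))).
  by rewrite -expRD (_ : t * b + (b - t * b) = b)//; ring.
have t1' : 0 <= 1 - t by rewrite subr_ge0.
have := lerD (ler_wpM2l t1' e1) (ler_wpM2l t0 e2).
lra.
Qed.

(** By convexity the exponential lies below its chord on [[0, 2]]. Integrating the chord gives the
    Bernoulli generating function with [p = m / 2] and [h = 2 * s], where [m] is the mean of [l]. *)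
Lemma hoeffding_mgf (d : measure_display) (X : measurableType d)
    (R : realType) (D : probability X R) (l : X -> R) (s : R) :
  measurable_fun setT l -> (forall x, 0 <= l x <= 2) -> 0 <= s ->
  \int[D]_x expR (- (s * l x)) <=
  expR (- (s * \int[D]_x l x) + s ^+ 2 / 2).
Proof.
move=> ml l02 s0.
have il : D.-integrable setT (EFin \o l).
  apply: (@integrable_bounded _ _ _ _ _ 2) => // x.
  by have /andP[l0 l2] := l02 x; rewrite ger0_norm.
have ie : D.-integrable setT (EFin \o (fun x => expR (- (s * l x)))).
  apply: (@integrable_bounded _ _ _ _ _ 1) => [|x].
    apply: measurableT_comp => //; apply: measurableT_comp => //.
    exact: measurable_funM.
  rewrite ger0_norm ?expR_ge0// -expR0 ler_expR oppr_le0 mulr_ge0//.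
  by have /andP[] := l02 x.
(* Slope of the chord of [expR (- (s * y))] between [y = 0] and [y = 2]. *)
pose k := (expR (- (2 * s)) - 1) / 2.
have ik : D.-integrable setT (EFin \o (fun x => k * l x)).
  apply: (@integrable_bounded _ _ _ _ _ (`|k| * 2)) => [|x].
    exact: measurable_funM.
  by have /andP[l0 l2] := l02 x; rewrite normrM ler_wpM2l// ger0_norm.
have i1 : D.-integrable setT (EFin \o (fun=> 1 : R)).
  by apply: (@integrable_bounded _ _ _ _ _ 1) => // x; rewrite normr1.
set m := \int[D]_x l x.
have m02 : 0 <= m <= 2.
  rewrite Rintegral_ge0 => [|x _]; last by have /andP[] := l02 x.
  have -> : 2 = \int[D]_x (2 : R).
    by rewrite Rintegral_cst//= probability_setT mulr1.
  apply: le_Rintegral => //.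
    by apply: (@integrable_bounded _ _ _ _ _ 2) => // x; rewrite ger0_norm.
  by move=> x _; have /andP[] := l02 x.
apply: (@le_trans _ _ (\int[D]_x (1 + k * l x))).
  apply: le_Rintegral => //.
    apply: (@integrable_bounded _ _ _ _ _ (1 + `|k| * 2)) => [|x].
      by apply: measurable_funD => //; exact: measurable_funM.
    rewrite (le_trans (ler_normD _ _))// normr1 lerD2l normrM ler_wpM2l//.
    by have /andP[l0 l2] := l02 x; rewrite ger0_norm.
  move=> x _.
  have l01 : 0 <= l x / 2 <= 1 by have := l02 x; lra.
  have := expR_le_chord (- (2 * s)) l01.
  rewrite (_ : l x / 2 * - (2 * s) = - (s * l x)); last by field.
  move=> /le_trans; apply; rewrite /k le_eqVlt; apply/orP; left; apply/eqP.
  by field.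
rewrite RintegralD// RintegralZl// Rintegral_cst//= probability_setT mulr1 -/m.
have m01 : 0 <= m / 2 <= 1 by lra.
have s20 : 0 <= 2 * s by rewrite mulr_ge0.
have := bernoulli_mgf_le m01 s20.
rewrite (_ : - (m / 2 * (2 * s)) + (2 * s) ^+ 2 / 8 = - (s * m) + s ^+ 2 / 2);
  last by field.
apply: le_trans; rewrite /k le_eqVlt; apply/orP; left; apply/eqP.
by field.
Qed.

Section hoeffding.
Context (dO d : measure_display) (Omega : measurableType dO)
  (X : measurableType d) (R : realType) (I : finType).
Variables (P : probability Omega R) (Y : I -> Omega -> X)
  (D : I -> probability X R) (l : I -> X -> R) (a : I -> R).
Hypothesis mY : forall i, measurable_fun setT (Y i).
Hypothesis lawY : forall i, has_law P (Y i) (D i).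
Hypothesis indepY : mutually_independent P Y.
Hypothesis ml : forall i, measurable_fun setT (l i).
Hypothesis l02 : forall i x, 0 <= l i x <= 2.
Hypothesis a0 : forall i, 0 <= a i.

Lemma integral_law i (f : X -> R) : measurable_fun setT f ->
  (forall x, 0 <= f x) ->
  (\int[P]_w (f (Y i w))%:E = \int[D i]_x (f x)%:E)%E.
Proof.
move=> mf f0.
have := @ge0_integral_pushforward _ _ _ _ R (Y i) (mY i) P
   setT (EFin \o f) measurableT.
rewrite preimage_setT => <-.
- by apply: eq_measure_integral => A mA _; rewrite -lawY.
- exact/measurable_EFinP.
- by move=> x _; rewrite lee_fin.
Qed.

(** Chernoff's method: Markov's inequality for the exponential of minus [s] times the sum,
    factorisation by independence, and [hoeffding_mgf] for each factor with parameter [s * a i]. *)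
Lemma hoeffding_lower_tail (t : R) : 0 < t -> 0 < \sum_i a i ^+ 2 ->
  (P [set w | (\sum_i a i * l i (Y i w) <=
               \sum_i a i * \int[D i]_x l i x - t)%R] <=
   (expR (- (t ^+ 2 / (2 * \sum_i a i ^+ 2))))%:E)%E.
Proof.
move=> t0; set V := \sum_i a i ^+ 2 => V0; set B := [set w | _].
have mZ : measurable_fun setT (fun w => \sum_i a i * l i (Y i w)).
  apply: measurable_sum => i; apply: measurable_funM => //.
  exact: measurableT_comp.
have mB : measurable B.
  rewrite -[B]setTI.
  rewrite (_ : B = (fun w => \sum_i a i * l i (Y i w)) @^-1`
     `]-oo, (\sum_i a i * \int[D i]_x l i x - t)]); last first.
    by apply/seteqP; split=> w /=; rewrite in_itv.
  exact: (mZ measurableT _ (measurable_itv _)).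
(* This [s] minimises the final exponent [- s * t + s ^+ 2 * V / 2], with minimum
   [- t ^+ 2 / (2 * V)]. *)
pose s := t / V; have s0 : 0 < s by rewrite divr_gt0.
pose f i x := expR (- (s * a i * l i x)).
pose e i := \int[D i]_x f i x.
have sa0 i : 0 <= s * a i by rewrite mulr_ge0// ltW.
have mf i : measurable_fun setT (f i).
  apply: measurableT_comp => //; apply: measurableT_comp => //.
  exact: measurable_funM.
have f0 i x : 0 <= f i x by rewrite expR_ge0.
have fe i : (\int[P]_w (f i (Y i w))%:E)%E = (e i)%:E.
  rewrite integral_law// /e /Rintegral fineK//.
  apply: integrable_fin_num => //.
  apply: (@integrable_bounded _ _ _ _ _ 1) => // x.
  rewrite ger0_norm// -expR0 ler_expR oppr_le0 mulr_ge0//.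
  by have /andP[] := l02 i x.
pose c := expR (s * (\sum_i a i * \int[D i]_x l i x - t)).
have mp : measurable_fun setT (EFin \o (fun w => \prod_i f i (Y i w))).
  apply/measurable_EFinP; apply: measurable_prod => i _.
  exact: measurableT_comp.
have p0 w : (0 <= (\prod_i f i (Y i w))%:E)%E by rewrite lee_fin; apply: prodr_ge0.
(* The indicator of [B] is at most the integrand, because on [B] the total exponent is
   nonnegative. *)
apply: (@le_trans _ _ (\int[P]_w (c%:E * (\prod_i f i (Y i w))%:E))%E).
  rewrite -[B]setIT -integral_indic//.
  apply: ge0_le_integral => //.
  - exact/measurable_EFinP.
  - exact: measurable_funeM.
  - move=> w _; rewrite -EFinM lee_fin /f -expR_sum -expRD sumrN.
    rewrite indicE; have [/set_mem Bw|_] := boolP (w \in B); last exact: expR_ge0.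
    rewrite -expR0 ler_expR subr_ge0.
    under eq_bigr do rewrite -mulrA.
    by rewrite -mulr_sumr ler_pM2l.
rewrite ge0_integralZl//; last by rewrite lee_fin expR_ge0.
rewrite (independent_integral_prod mY indepY mf f0 fe) -EFinM lee_fin.
apply: (@le_trans _ _ (c * \prod_i
    expR (- (s * a i * \int[D i]_x l i x) + (s * a i) ^+ 2 / 2))).
  rewrite ler_wpM2l ?expR_ge0// ler_prod// => i _.
  rewrite Rintegral_ge0//=; exact: hoeffding_mgf.
rewrite -expR_sum -expRD ler_expR big_split/= sumrN.
rewrite [X in _ + (- X + _)](eq_bigr (fun i => s * (a i * \int[D i]_x l i x)));
  last first.
  by move=> i _; rewrite mulrA.
rewrite -mulr_sumr.
rewrite [X in _ + (_ + X)](eq_bigr (fun i => s ^+ 2 / 2 * a i ^+ 2)); last first.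
  by move=> i _; rewrite exprMn mulrAC.
rewrite -mulr_sumr -/V.
rewrite le_eqVlt; apply/orP; left; apply/eqP; rewrite /s.
by field; rewrite gt_eqF.
Qed.

End hoeffding.

(** * Assembly of the generalization bound *)

Unset Implicit Arguments.

Theorem theorem2
  (R : realType) (C : nat) (hC : (2 <= C)%N)
  (d : measure_display) (X : measurableType d)
  (Dk Dproxy Dtest : probability X R)
  (hstar : X -> 'I_C -> R)
  (hstar_vertex : forall x, is_vertex (hstar x))
  (hstar_meas : meas_vec hstar)
  (hpstar : X -> 'I_C -> R)
  (hpstar_simplex : forall x, in_simplex (hpstar x))
  (hpstar_meas : meas_vec hpstar)
  (hpstar_hat : X -> 'I_C -> R)
  (hpstar_hat_def : forall x, exists c : 'I_C,
      hpstar_hat x = onehot R c /\ forall i, hpstar x i <= hpstar x c)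
  (hpstar_hat_meas : meas_vec hpstar_hat)
  (Hk : set (X -> 'I_C -> R))
  (Hk_vertex : forall h, Hk h -> forall x, is_vertex (h x))
  (Hk_meas : forall h, Hk h -> meas_vec h)
  (hk : X -> 'I_C -> R) (hk_in : Hk hk)
  (mk mp : nat) (hmk : (0 < mk)%N) (hmp : (0 < mp)%N)
  (dO : measure_display) (Omega : measurableType dO) (P : probability Omega R)
  (S : 'I_mk -> Omega -> X) (T : 'I_mp -> Omega -> X)
  (S_meas : forall i, measurable_fun setT (S i))
  (T_meas : forall j, measurable_fun setT (T j))
  (S_law : forall i, has_law P (S i) Dk)
  (T_law : forall j, has_law P (T j) Dproxy)
  (indep : mutually_independent P
     (fun z : ('I_mk + 'I_mp)%type =>
        match z with inl i => S i | inr j => T j end))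
  (alpha delta : R)
  (halpha : 0 <= alpha <= 1) (hdelta : 0 < delta < 1) :
  let E1 := [set x | hstar x <> hpstar_hat x] in
  let E2 := [set x | hstar x = hpstar_hat x] in
  let p1 := fine (Dproxy E1) in
  let p2 := fine (Dproxy E2) in
  let lambda_k := min_comb_loss Hk Dtest Dk hstar in
  let lambda_kp := min_comb_loss Hk Dtest Dproxy hstar in
  ((1 - delta)%:E <=
   P [set w | (loss Dtest hk hstar <=
        (alpha * emp_loss (fun i => S i w) hk hstar
         + (1 - alpha) * emp_loss (fun j => T j w) hk hpstar)
        + Num.sqrt ((2 * alpha ^+ 2 / mk%:R + 2 * (1 - alpha) ^+ 2 / mp%:R)
                    * ln (2 / delta))
        + alpha * (lambda_k + Gdist Hk Dk Dtest)
        + (1 - alpha) * (lambda_kp + Gdist Hk Dproxy Dtest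
                         + p1 * cond_loss Dproxy E1 hstar hpstar
                         + p2 * cond_loss Dproxy E2 hpstar_hat hpstar))%R])%E.
Proof.
cbv zeta; set E1 := [set x | hstar x <> _]; set E2 := [set x | hstar x = _].
set p1 := fine (Dproxy E1); set p2 := fine (Dproxy E2).
set lambda_k := min_comb_loss Hk Dtest Dk hstar.
set lambda_kp := min_comb_loss Hk Dtest Dproxy hstar.
have /andP[alpha0 alpha1] := halpha; have /andP[delta0 delta1] := hdelta.
have alpha1' : 0 <= 1 - alpha by rewrite subr_ge0.
have shk : simplex_predictor hk.
  by apply: vertex_simplex_predictor; [exact: Hk_meas|exact: Hk_vertex].
have sstar : simplex_predictor hstar by exact: vertex_simplex_predictor.
have sp : simplex_predictor hpstar by [].
have shat : simplex_predictor hpstar_hat.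
  apply: vertex_simplex_predictor => // x.
  by have [c [-> _]] := hpstar_hat_def x; exists c.
(* Both samples are pooled into one family, with weights making the training loss a single weighted
   sum of independent terms in which each [l z] takes values in [[0, 2]]. *)
pose I : finType := ('I_mk + 'I_mp)%type.
pose Y (z : I) := match z with inl i => S i | inr j => T j end.
pose D (z : I) := match z with inl _ => Dk | inr _ => Dproxy end.
pose l (z : I) := match z with
  | inl _ => fun x => l1dist (hk x) (hstar x)
  | inr _ => fun x => l1dist (hk x) (hpstar x) end.
pose a (z : I) := match z with
  | inl _ => alpha / mk%:R | inr _ => (1 - alpha) / mp%:R end.
have mk0 : (mk%:R : R) != 0 by rewrite pnatr_eq0 -lt0n.
have mp0 : (mp%:R : R) != 0 by rewrite pnatr_eq0 -lt0n.
have mY z : measurable_fun setT (Y z) by case: z.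
have lawY z : has_law P (Y z) (D z) by case: z.
have ml z : measurable_fun setT (l z).
  case: z => i; apply: measurable_l1dist => //; exact: Hk_meas.
have l02 z x : 0 <= l z x <= 2.
  case: shk sstar sp => _ s1 [_ s2] [_ s3].
  by case: z => i /=; rewrite l1dist_ge0 l1dist_simplex_le2.
have a0 z : 0 <= a z by case: z => i; rewrite divr_ge0.
pose V := \sum_z a z ^+ 2.
have VE : V = alpha ^+ 2 / mk%:R + (1 - alpha) ^+ 2 / mp%:R.
  rewrite /V big_sumType/= !sumr_const !card_ord -2!(mulr_natr (_ ^+ 2)).
  by field; rewrite mk0 mp0.
have V0 : 0 < V.
  (* The weights [alpha] and [1 - alpha] cannot both vanish, so one of the two terms is positive. *)
  rewrite VE; have [->|alphaN0] := eqVneq alpha 0.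
    by rewrite expr0n/= mul0r add0r subr0 expr1n divr_gt0// ltr0n.
  rewrite ltr_pwDl//; first by rewrite divr_gt0 ?ltr0n// exprn_gt0// lt_def alphaN0.
  by rewrite divr_ge0// exprn_ge0.
have L0 : 0 < ln (2 / delta).
  by rewrite ln_gt0// ltr_pdivlMr// mul1r (lt_trans delta1)// ltr1n.
set t := Num.sqrt _.
(* With this value the tail exponent [- t ^+ 2 / (2 * V)] becomes [- ln (2 / delta)]. *)
have tE : t ^+ 2 = 2 * V * ln (2 / delta).
  rewrite sqr_sqrtr; first by rewrite VE; ring.
  rewrite mulr_ge0 ?(ltW L0)// addr_ge0// divr_ge0// mulr_ge0// exprn_ge0//.
have t0 : 0 < t.
  rewrite lt_def sqrtr_ge0 andbT; apply/eqP => t0.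
  move: tE; rewrite t0 expr0n/= => /eqP.
  by rewrite eq_sym gt_eqF// mulr_gt0// mulr_gt0.
have meanE : \sum_z a z * \int[D z]_x l z x =
    alpha * loss Dk hk hstar + (1 - alpha) * loss Dproxy hk hpstar.
  rewrite big_sumType/= !sumr_const !card_ord -2!(mulr_natr (_ * _)).
  rewrite -!lossE.
  by field; rewrite mk0 mp0.
have empE w : \sum_z a z * l z (Y z w) =
    alpha * emp_loss (S^~ w) hk hstar + (1 - alpha) * emp_loss (T^~ w) hk hpstar.
  by rewrite big_sumType/= -!mulr_sumr !mulrA.
have mZ : measurable_fun setT (fun w => \sum_z a z * l z (Y z w)).
  apply: measurable_sum => z; apply: measurable_funM => //.
  exact: measurableT_comp.
have tail := hoeffding_lower_tail mY lawY indep ml l02 a0 t0 V0.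
set B := [set w | _] in tail; set G := [set w | _].
have mB : measurable B.
  rewrite -[B]setTI (_ : B = (fun w => \sum_z a z * l z (Y z w)) @^-1`
     `]-oo, (\sum_z a z * \int[D z]_x l z x - t)]); last first.
    by apply/seteqP; split=> w /=; rewrite in_itv.
  exact: (mZ measurableT _ (measurable_itv _)).
set r := alpha * (lambda_k + _) in G *; set r' := (1 - alpha) * _ in G *.
have mG : measurable G.
  (* The event depends on the samples only through the weighted sum, so it is the preimage of a
     half-line. *)
  rewrite -[G]setTI (_ : G = (fun w => \sum_z a z * l z (Y z w)) @^-1`
     `[(loss Dtest hk hstar - (t + r + r')), +oo[); last first.
    by apply/seteqP; split=> w; rewrite /G/= in_itv/= andbT empE => Hw; lra.
  exact: (mZ measurableT _ (measurable_itv _)).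
(* Outside [B] the population mean is less than the empirical sum plus [t]; what remains is
   deterministic and is the [alpha]-weighted combination of the private bound [k1] and the proxy
   bound [k5]. *)
have BG : ~` B `<=` G.
  move=> w /negP; rewrite -ltNge meanE empE /G/= => Bw.
  have k1 := loss_transfer Dk Dtest Hk_vertex Hk_meas sstar hk_in.
  have k2 := loss_transfer Dproxy Dtest Hk_vertex Hk_meas sstar hk_in.
  have k3 := loss_triangle Dproxy shk sp sstar.
  have k4 := loss_split Dproxy sstar shat sp.
  rewrite (lossC _ hpstar) k4 -/E1 -/E2 -/p1 -/p2 in k3.
  have k5 := le_trans k2 (lerD (lerD k3 (lexx _)) (lexx _)).
  have := lerD (ler_wpM2l alpha0 k1) (ler_wpM2l alpha1' k5).
  rewrite /r /r'; lra.
apply: (@le_trans _ _ (P (~` B))); last first.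
  by apply: le_measure => //; rewrite inE//; exact: measurableC.
(* The tail bound evaluates to [delta / 2], which is below [delta]. *)
rewrite probability_setC// -[P B]fineK ?fin_num_measure// -EFinB lee_fin lerB//.
rewrite -lee_fin fineK ?fin_num_measure//; apply: (le_trans tail).
rewrite lee_fin -/V tE mulrAC divff ?mul1r; last first.
  by rewrite mulf_neq0 ?gt_eqF.
rewrite expRN lnK ?posrE ?divr_gt0// invf_div; lra.
Qed.
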